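(* For every command $C$, deterministic assertion $\phi$, interpretation $I$ and probabilistic cq-state $\Theta$: $\Theta\models^I wp(C,\phi)$ if and only if $[\![C]\!](\Theta)\models^I\phi$.
   Context: Setting. Fix a set $\mathbb{PV}$ of classical program variables, a set $\mathbb{LV}$ of logical variables and quantum variables $q_1,\dots,q_m$, each with a 2-dimensional Hilbert space; $\mathcal H$ is their tensor product. Arithmetic expressions $E::=n\mid X\mid(E\ aop\ E)$ ($n\in\mathbb Z$); Boolean expressions $B::=\top\mid\bot\mid(E\ rop\ E)\mid\neg B\mid(B\wedge B)$. A classical state is $S:\mathbb{PV}\to\mathbb Z$. A quantum state is a unit vector of $\mathcal H$ up to global phase. A pure cq-state is $\theta=(\theta_c,\theta_q)$ (classical state, quantum state). A probabilistic cq-state is a subdistribution $\Theta$ on pure cq-states ($\sum\Theta(\theta)\le1$), with support $sp(\Theta)$; $\widehat\theta$ is the point distribution; $\downarrow_B(\Theta)(\theta)=\Theta(\theta)$ if $[\![B]\!]\theta_c=\top$, else $0$. Commands $C::=skip\mid X\leftarrow E\mid X\xleftarrow{\$}\{a_1:k_1,\dots,a_n:k_n\}\mid C_1;C_2\mid if\ B\ then\ C_1\ else\ C_2\mid while\ B\ do\ C\mid U[\overline q]\mid X\leftleftarrows q_i$ ($k_i\in\mathbb Z$, $0<a_i<1$, $\sum a_i=1$, $U$ unitary on qubits $\overline q$, $U_{\overline q}$ = $U$ on $\overline q$ tensored with identity). Semantics: $[\![skip]\!]\Theta=\Theta$; $[\![X\leftarrow E]\!]\widehat\theta=\widehat{(\theta_c[X\mapsto[\![E]\!]\theta_c],\theta_q)}$;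 $[\![X\xleftarrow{\$}\{a_i:k_i\}]\!]\Theta=\sum_i a_i[\![X\leftarrow k_i]\!]\Theta$; $[\![C_1;C_2]\!]=[\![C_2]\!]\circ[\![C_1]\!]$; $[\![if\ B\ then\ C_1\ else\ C_2]\!]\Theta=[\![C_1]\!](\downarrow_B\Theta)+[\![C_2]\!](\downarrow_{\neg B}\Theta)$; $[\![while\ B\ do\ C]\!]\Theta=\sum_{i\ge0}\downarrow_{\neg B}(([\![C]\!]\circ\downarrow_B)^i\Theta)$; $[\![U[\overline q]]\!]\widehat\theta=\widehat{(\theta_c,U_{\overline q}\theta_q)}$; $[\![X\leftleftarrows q_i]\!]\widehat\theta=\sum_{j=0}^1p_j\widehat{\theta_j}$ with $p_j=\mathrm{Tr}((|j\rangle\langle j|\otimes I_{-i})\theta_q\theta_q^\dagger)$, $\theta_{j,c}=\theta_c[X\mapsto j]$, $\theta_{j,q}=(|j\rangle\langle j|\otimes I_{-i})\theta_q/\sqrt{p_j}$ (weight-0 term if $p_j=0$); assignment, unitary and measurement extend linearly to arbitrary $\Theta$. Deterministic assertions $\phi::=\top\mid\bot\mid P^0_j\mid P^1_j\mid(e\ rop\ e)\mid\neg\phi\mid(\phi\wedge\phi)\mid\forall x\phi\mid[U_{\overline q}]\phi\mid[\mathfrak P^0_j]\phi\mid[\mathfrak P^1_j]\phi\mid\bigwedge_{i=0}^\infty\phi_i$, $e::=n\mid X\mid x\mid(e\ aop\ e)$; $\vee,\to$ abbreviations; Boolean expressions are assertions. Interpretation $I:\mathbb{LV}\to\mathbb Z$.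 $\theta\models^I\phi$: $P^i_j$ iff $\mathrm{Tr}(|i\rangle\langle i|\mathrm{Tr}_{-j}(\theta_q\theta_q^\dagger))=1$; $e_1\ rop\ e_2$ iff it holds with $X\mapsto\theta_c(X)$, $x\mapsto I(x)$; $\neg,\wedge,\bigwedge$ classical; $\forall x\phi$ iff $\theta\models^{I[x\mapsto n]}\phi$ for all $n\in\mathbb Z$; $[U_{\overline q}]\phi$ iff $(\theta_c,U_{\overline q}\theta_q)\models^I\phi$; $[\mathfrak P^i_j]\phi$ iff $p_i=\mathrm{Tr}((|i\rangle\langle i|_j\otimes I_{-j})\theta_q\theta_q^\dagger)>0$ and $(\theta_c,(|i\rangle\langle i|_j\otimes I_{-j})\theta_q/\sqrt{p_i})\models^I\phi$. $\Theta\models^I\phi$ iff every $\theta\in sp(\Theta)$ satisfies $\phi$. $\phi[X/E]$ is substitution of $E$ for $X$. Weakest precondition $wp(C,\phi)$ (a deterministic assertion), by recursion on $C$: $wp(skip,\phi)=\phi$; $wp(X\leftarrow E,\phi)=\phi[X/E]$; $wp(X\xleftarrow{\$}\{a_1:k_1,\dots,a_n:k_n\},\phi)=\phi[X/k_1]\wedge\cdots\wedge\phi[X/k_n]$; $wp(C_1;C_2,\phi)=wp(C_1,wp(C_2,\phi))$; $wp(if\ B\ then\ C_1\ else\ C_2,\phi)=(B\wedge wp(C_1,\phi))\vee(\neg B\wedge wp(C_2,\phi))$; $wp(while\ B\ do\ C,\phi)=\bigwedge_{k=0}^\infty\psi_k$ with $\psi_0=\top$, $\psi_{i+1}=(B\wedge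 wp(C,\psi_i))\vee(\neg B\wedge\phi)$; $wp(U[\overline q],\phi)=[U_{\overline q}]\phi$; $wp(X\leftleftarrows q_j,\phi)=([\mathfrak P^0_j]\phi[X/0]\vee P^1_j)\wedge([\mathfrak P^1_j]\phi[X/1]\vee P^0_j)$. *)

(* Defs.v *)
From HB Require Import structures.
From mathcomp Require Import all_boot all_order all_algebra.
From mathcomp Require Import spectral.
From mathcomp Require Import all_classical all_reals all_analysis.
From mathcomp Require Import complex.

Set Implicit Arguments.
Unset Strict Implicit.
Unset Printing Implicit Defensive.

Import Order.TTheory GRing.Theory Num.Theory.

Local Open Scope classical_set_scope.
Local Open Scope quotient_scope.
Local Open Scope sesquilinear_scope.
Local Open Scope ring_scope.

(* The computational basis of m qubits is indexed by {0,1}^m; vectors and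
   operators are matrices whose indices are transported along
   enum_rank / enum_val, so that dim m = 2 ^ m. *)
Definition bits (m : nat) : Type := {ffun 'I_m -> bool}.
HB.instance Definition _ m := Finite.on (bits m).

Definition dim (m : nat) : nat := #|{: bits m}|.

Section Operators.
Context (R : realType).
Local Notation C := R[i].

Definition agree_off m k (q : k.-tuple 'I_m) (s t : bits m) : bool :=
  [forall i, (i \notin q) ==> (s i == t i)].

Definition bits_at m k (q : k.-tuple 'I_m) (s : bits m) : bits k :=
  [ffun l => s (tnth q l)].

(* The operator A on the (pairwise distinct) qubits q, tensored with the
   identity on all the others. *)
Definition tensor_id m k (q : k.-tuple 'I_m) (A : 'M[C]_(dim k)) :
    'M[C]_(dim m) :=
  \matrix_(a, b)
    if agree_off q (enum_val a) (enum_val b)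
    then A (enum_rank (bits_at q (enum_val a)))
           (enum_rank (bits_at q (enum_val b)))
    else 0.

(* |b><b| on a single qubit *)
Definition ketbra (b : bool) : 'M[C]_(dim 1) :=
  let e := enum_rank ([ffun=> b] : bits 1) in delta_mx e e.

(* |b><b|_j (x) I_{-j} *)
Definition proj m (b : bool) (j : 'I_m) : 'M[C]_(dim m) :=
  tensor_id [tuple j] (ketbra b).

(* Tr_{-j}: trace out every qubit but j *)
Definition ptrace m (j : 'I_m) (rho : 'M[C]_(dim m)) : 'M[C]_(dim 1) :=
  \matrix_(a, b)
    \sum_(s : bits m) \sum_(t : bits m |
        [&& agree_off [tuple j] s t,
            enum_rank (bits_at [tuple j] s) == a &
            enum_rank (bits_at [tuple j] t) == b])
      rho (enum_rank s) (enum_rank t).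

Definition unit_vec m : pred 'cV[C]_(dim m) :=
  fun v => \sum_a `|v a 0| ^+ 2 == 1.

Record gate m := Gate {
  gate_arity : nat;
  gate_qubits : gate_arity.-tuple 'I_m;
  gate_uniq : uniq gate_qubits;
  gate_mx : 'M[C]_(dim gate_arity);
  gate_unitary : gate_mx \is unitarymx }.

Definition gate_op m (U : gate m) : 'M[C]_(dim m) :=
  tensor_id (gate_qubits U) (gate_mx U).

Lemma agree_offC m k (q : k.-tuple 'I_m) s t :
  agree_off q s t = agree_off q t s.
Proof. by apply: eq_forallb => i; rewrite eq_sym. Qed.

Lemma agree_off_trans m k (q : k.-tuple 'I_m) s t u :
  agree_off q s t -> agree_off q t u -> agree_off q s u.
Proof.
move=> /forallP st /forallP tu; apply/forallP => i; apply/implyP => iq.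
by move: (st i) (tu i); rewrite iq /= => /eqP -> /eqP ->.
Qed.

Lemma bits_at_inj m k (q : k.-tuple 'I_m) s t :
  agree_off q s t -> bits_at q s = bits_at q t -> s = t.
Proof.
move=> /forallP st /ffunP e; apply/ffunP => i.
have [/tnthP[l ->]|iq] := boolP (i \in q); last first.
  by have := st i; rewrite iq => /eqP.
by have := e l; rewrite !ffunE.
Qed.

Lemma sum_agree_off m k (q : k.-tuple 'I_m) (s : bits m)
    (F : bits k -> C) : uniq q ->
  \sum_(u | agree_off q s u) F (bits_at q u) = \sum_r F r.
Proof.
move=> uq.
pose put (r : bits k) : bits m :=
  [ffun i => if insub (index i q) is Some l then r l else s i].
have putK r : bits_at q (put r) = r.
  apply/ffunP => l; rewrite !ffunE.
  have e : index (tnth q l) q = l.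
    by rewrite (tnth_nth (tnth q l)) index_uniq ?size_tuple.
  case: insubP => [l' _|]; last by rewrite e ltn_ord.
  by rewrite /= e => /val_inj ->.
have put_agree r : agree_off q s (put r).
  apply/forallP => i; apply/implyP => iq; rewrite ffunE.
  by case: insubP => // l; rewrite -[X in (_ < X)%N](size_tuple q) index_mem (negbTE iq).
rewrite (reindex_onto put (bits_at q)) /=; last first.
  move=> u su; apply: (@bits_at_inj _ _ q); last exact: putK.
  by apply: agree_off_trans su; rewrite agree_offC.
by apply: eq_big => [r|r _]; rewrite putK ?put_agree ?eqxx.
Qed.

Lemma tensor_id_unitary m k (q : k.-tuple 'I_m) (A : 'M[C]_(dim k)) :
  uniq q -> A \is unitarymx -> tensor_id q A \is unitarymx.
Proof.
move=> uq /unitarymxP AA; apply/unitarymxP/matrixP => a b; rewrite !mxE.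
set s := enum_val a; set t := enum_val b.
have -> : (a == b) = (s == t).
  by rewrite /s /t (inj_eq enum_val_inj).
rewrite (reindex (@enum_rank (bits m))) /=; last first.
  by exists enum_val => ? _; [exact: enum_rankK|exact: enum_valK].
have [st|nst] := boolP (agree_off q s t); last first.
  have -> : (s == t) = false.
    apply: contraNF nst => /eqP ->.
    by apply/forallP => i; rewrite eqxx implybT.
  rewrite big1 // => u _; rewrite !mxE !enum_rankK.
  have [su|_] := boolP (agree_off q s u); last by rewrite mul0r.
  have [tu|_] := boolP (agree_off q t u); last by rewrite conjC0 mulr0.
  by rewrite (agree_off_trans su) // agree_offC in nst.
have /matrixP/(_ (enum_rank (bits_at q s)) (enum_rank (bits_at q t))) := AA.
rewrite !mxE (inj_eq enum_rank_inj).
have -> : (bits_at q s == bits_at q t) = (s == t).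
  by apply/eqP/eqP => [/(bits_at_inj st)|->].
move=> <-.
rewrite [RHS](reindex (@enum_rank (bits k))) /=; last first.
  by exists enum_val => ? _; [exact: enum_rankK|exact: enum_valK].
rewrite -(@sum_agree_off _ _ q s) // [RHS]big_mkcond /=.
apply: eq_bigr => u _; rewrite !mxE !enum_rankK -/s -/t.
have -> : agree_off q t u = agree_off q s u.
  by apply/idP/idP => [|su]; [exact: agree_off_trans|
     apply: agree_off_trans su; rewrite agree_offC].
by case: ifP => _ //; rewrite mul0r.
Qed.

Lemma gate_op_unitary m (U : gate m) : gate_op U \is unitarymx.
Proof. exact: tensor_id_unitary (gate_uniq U) (gate_unitary U). Qed.

Lemma unit_vecE m (v : 'cV[C]_(dim m)) : unit_vec v = (v^t* *m v == 1%:M).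
Proof.
have e : (v^t* *m v) 0 0 = \sum_a `|v a 0| ^+ 2.
  by rewrite mxE; apply: eq_bigr => a _; rewrite !mxE normCK mulrC.
apply/eqP/eqP => [h|/matrixP/(_ 0 0)]; last by rewrite e mxE.
by apply/matrixP => i j; rewrite !ord1 e h mxE.
Qed.

Lemma unit_vec_unitary m (U : 'M[C]_(dim m)) v :
  U \is unitarymx -> unit_vec v -> unit_vec (U *m v).
Proof.
rewrite !unit_vecE -trmxC_unitary => /unitarymxP; rewrite trmxCK => UU /eqP vv.
by rewrite trmx_mul map_mxM /= mulmxA -(mulmxA (v^t*)) UU mulmx1 vv.
Qed.

Lemma projE m b (j : 'I_m) a c :
  proj b j a c = ((a == c) && (enum_val a j == b))%:R.
Proof.
rewrite !mxE !(inj_eq enum_rank_inj).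
have atE (s : bits m) : (bits_at [tuple j] s == [ffun=> b]) = (s j == b).
  apply/eqP/eqP => [/ffunP/(_ ord0)|e]; first by rewrite !ffunE (tnth_nth j).
  by apply/ffunP => l; rewrite !ffunE !ord1 (tnth_nth j).
rewrite !atE; have [->|ac] := eqVneq a c.
  by rewrite andbb ifT //; apply/forallP => i; rewrite eqxx implybT.
case: ifPn => // agr.
case: (enum_val a j =P b) => //= e1; case: (enum_val c j =P b) => //= e2.
case/eqP: ac; apply: enum_val_inj; apply: (bits_at_inj agr); apply/ffunP => l.
by rewrite !ffunE !ord1 (tnth_nth j) /= e1 e2.
Qed.

Record unit_vector m := UnitVector {
  uvec :> 'cV[C]_(dim m);
  uvecP : unit_vec uvec }.

HB.instance Definition _ m := [isSub for @uvec m].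
HB.instance Definition _ m := [Choice of unit_vector m by <:].

Definition phase_eq m (v w : unit_vector m) : bool :=
  `[< exists c : C, `|c| = 1 /\ uvec v = c *: uvec w >].

Lemma phase_eq_refl m : reflexive (@phase_eq m).
Proof. by move=> v; apply/asboolP; exists 1; rewrite normr1 scale1r. Qed.

Lemma phase_eq_sym m : symmetric (@phase_eq m).
Proof.
have h (v w : unit_vector m) : phase_eq v w -> phase_eq w v.
  move=> /asboolP[c [c1 e]]; apply/asboolP; exists c^-1.
  by rewrite e normfV c1 invr1 scalerA mulVf ?scale1r // -normr_eq0 c1 oner_eq0.
by move=> v w; apply/idP/idP; exact: h.
Qed.

Lemma phase_eq_trans m : transitive (@phase_eq m).
Proof.
move=> v u w /asboolP[c [c1 e]] /asboolP[d [d1 f]]; apply/asboolP.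
by exists (c * d); rewrite e f normrM c1 d1 mulr1 scalerA.
Qed.

Canonical phase_equiv m :=
  EquivRel (@phase_eq m) (@phase_eq_refl m) (@phase_eq_sym m) (@phase_eq_trans m).

Definition qstate m : Type := {eq_quot (phase_equiv m)}.
HB.instance Definition _ m := Choice.on (qstate m).
HB.instance Definition _ m := Quotient.on (qstate m).

Lemma repr_pi m (v : unit_vector m) :
  exists2 c : C, `|c| = 1 & uvec (repr (\pi_(qstate m) v)) = c *: uvec v.
Proof.
have : repr (\pi_(qstate m) v) = v %[mod {eq_quot (phase_equiv m)}].
  by rewrite reprK.
by move/eqmodP/asboolP => [c [? ?]]; exists c.
Qed.

(* Operations on states are computed on an arbitrary representative; the lemmas
   density_pi, apply_gate_pi, meas_prob_pi and collapse_pi state that the choice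
   of the representative is irrelevant. *)

Definition density m (th : qstate m) : 'M[C]_(dim m) :=
  let v := uvec (repr th) in v *m v^t*.

Lemma density_pi m (v : unit_vector m) :
  density (\pi_(qstate m) v) = uvec v *m (uvec v)^t*.
Proof.
rewrite /density; have [c c1 ->] := repr_pi v.
rewrite linearZ /= map_mxZ -scalemxAl -scalemxAr scalerA.
by rewrite -normCK c1 expr1n scale1r.
Qed.

Lemma apply_gate_unit m (U : gate m) (v : unit_vector m) :
  unit_vec (gate_op U *m uvec v).
Proof. exact: unit_vec_unitary (gate_op_unitary U) (uvecP v). Qed.

Definition apply_gate m (U : gate m) (th : qstate m) : qstate m :=
  \pi_(qstate m) (UnitVector (apply_gate_unit U (repr th))).

Lemma apply_gate_pi m (U : gate m) (v : unit_vector m) :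
  apply_gate U (\pi_(qstate m) v) =
  \pi_(qstate m) (UnitVector (apply_gate_unit U v)).
Proof.
apply/eqmodP/asboolP; have [c c1 e] := repr_pi v.
by exists c; split => //=; rewrite e -scalemxAr.
Qed.

Definition meas_prob m (b : bool) (j : 'I_m) (th : qstate m) : R :=
  complex.Re (\tr (proj b j *m density th)).

Definition collapse_vec m (b : bool) (j : 'I_m) (th : qstate m) :
    'cV[C]_(dim m) :=
  ((Num.sqrt (meas_prob b j th))^-1)%:C%C *: (proj b j *m uvec (repr th)).

(* When the outcome b has probability 0 the default branch of insubd is taken
   (the state is left unchanged); it is never used otherwise, by
   collapse_vec_unit. *)
Definition collapse m (b : bool) (j : 'I_m) (th : qstate m) : qstate m :=
  \pi_(qstate m) (insubd (repr th) (collapse_vec b j th)).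

Lemma tr_proj_density m b (j : 'I_m) (th : qstate m) :
  \tr (proj b j *m density th) =
  \sum_(a | (enum_val a : bits m) j == b) `|uvec (repr th) a 0| ^+ 2.
Proof.
rewrite /mxtrace [RHS]big_mkcond; apply: eq_bigr => a _; rewrite mxE (bigD1 a) //=.
rewrite big1 ?addr0 => [|c ca]; last first.
  by rewrite projE eq_sym (negbTE ca) mul0r.
rewrite projE eqxx /=; case: ifP => _; last by rewrite mul0r.
by rewrite mul1r mxE big_ord1 !mxE normCK.
Qed.

Lemma meas_probE m b (j : 'I_m) (th : qstate m) :
  (meas_prob b j th)%:C%C =
  \sum_(a | (enum_val a : bits m) j == b) `|uvec (repr th) a 0| ^+ 2.
Proof.
rewrite /meas_prob tr_proj_density RRe_real // ger0_real //.
by apply: sumr_ge0 => a _; rewrite exprn_ge0.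
Qed.

Lemma meas_prob_ge0 m b (j : 'I_m) (th : qstate m) : 0 <= meas_prob b j th.
Proof. by rewrite -lecR meas_probE; apply: sumr_ge0 => a _; rewrite exprn_ge0. Qed.

Lemma meas_prob_sum m (j : 'I_m) (th : qstate m) :
  meas_prob false j th + meas_prob true j th = 1.
Proof.
apply: complexI; rewrite rmorphD /= !meas_probE rmorph1.
have /eqP <- := uvecP (repr th).
rewrite [RHS](bigID (fun a => (enum_val a : bits m) j == false)) /=; congr (_ + _).
by apply: eq_bigl => a; case: ((enum_val a : bits m) j).
Qed.

Lemma collapse_vec_unit m b (j : 'I_m) (th : qstate m) :
  0 < meas_prob b j th -> unit_vec (collapse_vec b j th).
Proof.
move=> p0; apply/eqP; rewrite /collapse_vec; set p := meas_prob b j th.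
transitivity (((p^-1)%:C)%C * \sum_(a | (enum_val a : bits m) j == b) `|uvec (repr th) a 0| ^+ 2).
  rewrite [in RHS]big_mkcond mulr_sumr; apply: eq_bigr => a _.
  rewrite !mxE (bigD1 a) //= big1 ?addr0 => [|c ca]; last first.
    by rewrite projE eq_sym (negbTE ca) mul0r.
  rewrite projE eqxx /=; case: ifP => _; last by rewrite mul0r mulr0 normr0 expr0n mulr0.
  rewrite mul1r normrM exprMn; congr (_ * _).
  rewrite ger0_norm ?lecR ?invr_ge0 ?sqrtr_ge0 // -rmorphXn /= exprVn sqr_sqrtr //.
  exact: ltW.
by rewrite -meas_probE -rmorphM /= mulVf ?rmorph1 // gt_eqF.
Qed.

Lemma meas_prob_pi m b (j : 'I_m) (v : unit_vector m) :
  meas_prob b j (\pi_(qstate m) v) =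
  complex.Re (\tr (proj b j *m (uvec v *m (uvec v)^t*))).
Proof. by rewrite /meas_prob density_pi. Qed.

Lemma collapse_pi m b (j : 'I_m) (v w : unit_vector m) :
  let p := meas_prob b j (\pi_(qstate m) v) in
  0 < p -> uvec w = ((Num.sqrt p)^-1)%:C%C *: (proj b j *m uvec v) ->
  collapse b j (\pi_(qstate m) v) = \pi_(qstate m) w.
Proof.
move=> p p0 wE; apply/eqmodP/asboolP; have [c c1 e] := repr_pi v.
exists c; split=> //.
have -> : uvec (insubd (repr (\pi_(qstate m) v))
    (collapse_vec b j (\pi_(qstate m) v))) = collapse_vec b j (\pi_(qstate m) v).
  exact: insubdK (collapse_vec_unit p0).
by rewrite /collapse_vec -/p e wE -scalemxAr !scalerA mulrC.
Qed.

End Operators.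

(* The operators aop and rop are left unspecified: any sets of symbols, with
   any total interpretations over the integers. *)
Record opsig := OpSig {
  aop : Type;
  aop_sem : aop -> int -> int -> int;
  rop : Type;
  rop_sem : rop -> int -> int -> bool }.

Inductive aexp (sig : opsig) (PV : Type) : Type :=
| EInt of int
| EVar of PV
| EOp of aop sig & aexp sig PV & aexp sig PV.

Inductive bexp (sig : opsig) (PV : Type) : Type :=
| BTop
| BBot
| BRel of rop sig & aexp sig PV & aexp sig PV
| BNot of bexp sig PV
| BAnd of bexp sig PV & bexp sig PV.

(* {a_1 : k_1, ..., a_n : k_n}, as the list of the pairs (a_i, k_i) *)
Record rdist (R : realType) := RDist {
  rdist_seq :> seq (R * int);
  rdist_itv : all (fun ak => 0 < ak.1 < 1) rdist_seq;
  rdist_sum : \sum_(ak <- rdist_seq) ak.1 = 1 }.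

Inductive cmd (R : realType) (m : nat) (sig : opsig) (PV : Type) : Type :=
| Skip
| Assign of PV & aexp sig PV
| Rand of PV & rdist R
| Seq of cmd R m sig PV & cmd R m sig PV
| If of bexp sig PV & cmd R m sig PV & cmd R m sig PV
| While of bexp sig PV & cmd R m sig PV
| Unitary of gate R m
| Measure of PV & 'I_m.

Inductive lexp (sig : opsig) (PV LV : Type) : Type :=
| LInt of int
| LPVar of PV
| LLVar of LV
| LOp of aop sig & lexp sig PV LV & lexp sig PV LV.

(* AProj b j is P^b_j, ABox b j phi is [frakP^b_j] phi. *)
Inductive assertion (R : realType) (m : nat) (sig : opsig) (PV LV : Type) : Type :=
| ATop
| ABot
| AProj of bool & 'I_m
| ARel of rop sig & lexp sig PV LV & lexp sig PV LV
| ANot of assertion R m sig PV LV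
| AAnd of assertion R m sig PV LV & assertion R m sig PV LV
| AForall of LV & assertion R m sig PV LV
| AGate of gate R m & assertion R m sig PV LV
| ABox of bool & 'I_m & assertion R m sig PV LV
| ABigAnd of (nat -> assertion R m sig PV LV).

Arguments EInt {sig PV}.
Arguments BTop {sig PV}.
Arguments BBot {sig PV}.
Arguments Skip {R m sig PV}.
Arguments Rand {R m sig PV}.
Arguments Unitary {R m sig PV}.
Arguments Measure {R m sig PV}.
Arguments LInt {sig PV LV}.
Arguments LPVar {sig PV LV}.
Arguments LLVar {sig PV LV}.
Arguments ATop {R m sig PV LV}.
Arguments ABot {R m sig PV LV}.
Arguments AProj {R m sig PV LV}.
Arguments ARel {R m sig PV LV}.

Definition upd (V : eqType) (S : V -> int) (X : V) (n : int) : V -> int :=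
  fun Y => if Y == X then n else S Y.

Section Expressions.
Context (sig : opsig) (PV : eqType) (LV : Type).

Fixpoint aeval (E : aexp sig PV) (S : PV -> int) : int :=
  match E with
  | EInt n => n
  | EVar X => S X
  | EOp o E1 E2 => aop_sem o (aeval E1 S) (aeval E2 S)
  end.

Fixpoint beval (B : bexp sig PV) (S : PV -> int) : bool :=
  match B with
  | BTop => true
  | BBot => false
  | BRel r E1 E2 => rop_sem r (aeval E1 S) (aeval E2 S)
  | BNot B1 => ~~ beval B1 S
  | BAnd B1 B2 => beval B1 S && beval B2 S
  end.

Fixpoint leval (e : lexp sig PV LV) (S : PV -> int) (I : LV -> int) : int :=
  match e with
  | LInt n => n
  | LPVar X => S X
  | LLVar x => I x
  | LOp o e1 e2 => aop_sem o (leval e1 S I) (leval e2 S I)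
  end.

Fixpoint lexp_of_aexp (E : aexp sig PV) : lexp sig PV LV :=
  match E with
  | EInt n => LInt n
  | EVar X => LPVar X
  | EOp o E1 E2 => LOp o (lexp_of_aexp E1) (lexp_of_aexp E2)
  end.

Fixpoint lsubst (X : PV) (E : aexp sig PV) (e : lexp sig PV LV) : lexp sig PV LV :=
  match e with
  | LInt n => LInt n
  | LPVar Y => if Y == X then lexp_of_aexp E else LPVar Y
  | LLVar x => LLVar x
  | LOp o e1 e2 => LOp o (lsubst X E e1) (lsubst X E e2)
  end.

End Expressions.

Section Semantics.
Context (R : realType) (m : nat) (sig : opsig) (PV : eqType).
Local Open Scope ereal_scope.

Definition cqstate : Type := ((PV -> int) * qstate R m)%type.
HB.instance Definition _ := Choice.on cqstate.

(* Mass functions take extended real values only so that all the sums below are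
   defined unconditionally; the values of a subdist lie in [0, 1]. *)
Local Notation mass := (cqstate -> \bar R).

Definition total (M : mass) : \bar R := \esum_(th in [set: cqstate]) M th.

Record subdist := SubDist {
  subdist_mass :> mass;
  subdist_ge0 : forall th, 0 <= subdist_mass th;
  subdist_le1 : total subdist_mass <= 1 }.

Definition supp (Theta : subdist) : set cqstate := [set th | 0 < Theta th].

Definition point (th : cqstate) : mass := fun th' => (th' == th)%:R%:E.

Definition restrict (B : bexp sig PV) (M : mass) : mass :=
  fun th => if beval B th.1 then M th else 0.

(* The linear extension of the map sending point th to k th. *)
Definition lin_ext (k : cqstate -> mass) (M : mass) : mass :=
  fun th' => \esum_(th in [set: cqstate]) (M th * k th th').

Definition assign_sem (X : PV) (E : aexp sig PV) : mass -> mass :=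
  lin_ext (fun th => point (upd th.1 X (aeval E th.1), th.2)).

Definition gate_sem (U : gate R m) : mass -> mass :=
  lin_ext (fun th => point (th.1, apply_gate U th.2)).

Definition measure_sem (X : PV) (j : 'I_m) : mass -> mass :=
  lin_ext (fun th th' => \sum_(b : bool)
    (meas_prob b j th.2)%:E *
    point (upd th.1 X (b : nat)%:Z, collapse b j th.2) th').

Fixpoint mass_sem (c : cmd R m sig PV) (M : mass) : mass :=
  match c with
  | Skip => M
  | Assign X E => assign_sem X E M
  | Rand X d => fun th => \sum_(ak <- d) ak.1%:E * assign_sem X (EInt ak.2) M th
  | Seq c1 c2 => mass_sem c2 (mass_sem c1 M)
  | If B c1 c2 => fun th =>
      mass_sem c1 (restrict B M) th + mass_sem c2 (restrict (BNot B) M) th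
  | While B c1 => fun th =>
      \sum_(0 <= i <oo)
        restrict (BNot B) (iter i (fun M' => mass_sem c1 (restrict B M')) M) th
  | Unitary U => gate_sem U M
  | Measure X j => measure_sem X j M
  end.

Definition nneg (M : mass) : Prop := forall th, 0 <= M th.

Lemma nneg_restrict B M : nneg M -> nneg (restrict B M).
Proof. by move=> M0 th; rewrite /restrict; case: ifP. Qed.

Lemma nneg_point th : nneg (point th).
Proof. by move=> th'; rewrite /point lee_fin ler0n. Qed.

Lemma total_point th : total (point th) = 1.
Proof.
rewrite /total (esumID [set th]) => [|th' _]; last exact: nneg_point.
rewrite setTI esum_set1; last exact: nneg_point.
rewrite esum1 => [|th' [_ /= ne]]; first by rewrite /point eqxx adde0.
by rewrite /point; case: eqP.
Qed.

Lemma total_ge0 M : nneg M -> 0 <= total M.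
Proof. by move=> M0; apply: esum_ge0. Qed.

Lemma total_restrictID B M : nneg M ->
  total M = total (restrict B M) + total (restrict (BNot B) M).
Proof.
move=> M0; rewrite /total -esumD; try by move=> th _; exact: nneg_restrict.
by apply: eq_esum => th _; rewrite /restrict /=; case: beval; rewrite ?adde0 ?add0e.
Qed.

Lemma le_esumZ (T : choiceType) (x : \bar R) (f : T -> \bar R) :
  0 <= x -> (forall t, 0 <= f t) -> \esum_(t in [set: T]) f t <= 1 ->
  \esum_(t in [set: T]) (x * f t) <= x.
Proof.
move=> x0 f0 f1; apply: ge_ereal_sup => /= _ [A [finA _] <-].
rewrite -ge0_mule_fsumr; last by [].
rewrite -[leRHS]mule1; apply: lee_wpmul2l => //; apply: le_trans f1.
by apply: ereal_sup_ubound; exists A.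
Qed.

Lemma nneg_lin_ext k M : (forall th, nneg (k th)) -> nneg M -> nneg (lin_ext k M).
Proof.
by move=> k0 M0 th; apply: esum_ge0 => t _; apply: mule_ge0; [exact: M0|exact: k0].
Qed.

Lemma total_lin_ext k M :
  (forall th, nneg (k th)) -> (forall th, total (k th) <= 1) -> nneg M ->
  total (lin_ext k M) <= total M.
Proof.
move=> k0 k1 M0; rewrite /total /lin_ext.
have kM0 th th' : 0 <= M th * k th th'.
  by apply: mule_ge0; [exact: M0|exact: k0].
rewrite (esum_esum (a := fun th' th => M th * k th th')) //.
rewrite (reindex_esum ([set: cqstate] `*`` fun=> [set: cqstate]) _
  (fun x => (x.2, x.1))) /=; last first.
  by split=> [//|[a b] [c d] _ _ [-> ->]//|[a b] _ /=]; exists (b, a).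
rewrite -(esum_esum (a := fun th th' => M th * k th th')) //.
by apply: le_esum => th _; apply: le_esumZ; [exact: M0|exact: k0|exact: k1].
Qed.

Lemma nneg_assign_sem X E M : nneg M -> nneg (assign_sem X E M).
Proof. by apply: nneg_lin_ext => th; exact: nneg_point. Qed.

Lemma total_assign_sem X E M : nneg M -> total (assign_sem X E M) <= total M.
Proof.
apply: total_lin_ext => th; first exact: nneg_point.
by rewrite total_point.
Qed.

Lemma mass_sem_le c M : nneg M ->
  nneg (mass_sem c M) /\ total (mass_sem c M) <= total M.
Proof.
elim: c M => [|X E|X d|c1 IH1 c2 IH2|B c1 IH1 c2 IH2|B c1 IH1|U|X j] M M0 /=.
- by [].
- by split; [exact: nneg_assign_sem|exact: total_assign_sem].
- have d0 ak : ak \in rdist_seq d -> 0 <= (ak.1)%:E.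
    by move=> /(allP (rdist_itv d)) /andP[/ltW]; rewrite lee_fin.
  have t0 ak th : ak \in rdist_seq d ->
      0 <= (ak.1)%:E * assign_sem X (EInt ak.2) M th.
    by move=> /d0 a0; apply: mule_ge0 => //; exact: nneg_assign_sem.
  split=> [th|]; first by rewrite big_seq; apply: sume_ge0 => ak; exact: t0.
  rewrite /total; under eq_esum do rewrite big_seq.
  rewrite esum_sum => [|th ak _ akd]; last exact: t0.
  apply: (@le_trans _ _ (\sum_(ak <- d | ak \in rdist_seq d) (ak.1)%:E * total M)).
    apply: lee_sum => ak akd; apply: ge_ereal_sup => /= _ [A [finA _] <-].
    rewrite -ge0_mule_fsumr => [|th]; last exact: nneg_assign_sem.
    apply: lee_wpmul2l; first exact: d0.
    apply: le_trans (total_assign_sem X (EInt ak.2) M0).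
    by apply: ereal_sup_ubound; exists A.
  rewrite -ge0_sume_distrl; last by move=> ak; exact: d0.
  by rewrite -big_seq sumEFin rdist_sum mul1e.
- have [h1 t1] := IH1 M M0; have [h2 t2] := IH2 _ h1.
  by split=> //; exact: le_trans t2 t1.
- have [h1 t1] := IH1 _ (nneg_restrict B M0).
  have [h2 t2] := IH2 _ (nneg_restrict (BNot B) M0).
  split=> [th|]; first by apply: adde_ge0; [exact: h1|exact: h2].
  rewrite /total esumD => [|th _|th _]; [|exact: h1|exact: h2].
  by rewrite -!/(total _) (total_restrictID B M0); apply: leeD.
- set step := fun M' => mass_sem c1 (restrict B M').
  have N0 i : nneg (iter i step M).
    by elim: i => [//|i IHi]; have [] := IH1 _ (nneg_restrict B IHi).
  have R0 i : nneg (restrict (BNot B) (iter i step M)) by exact: nneg_restrict.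
  split=> [th|]; first by apply: nneseries_ge0 => i _ _; exact: (R0 i th).
  have partial n : \sum_(0 <= i < n) total (restrict (BNot B) (iter i step M)) +
      total (iter n step M) <= total M.
    elim: n => [|n IHn]; first by rewrite big_geq // add0e.
    apply: le_trans IHn; rewrite big_nat_recr //= -addeA; apply: leeD => //.
    rewrite (total_restrictID B (N0 n)) addeC; apply: leeD => //.
    by have [] := IH1 _ (nneg_restrict B (N0 n)).
  rewrite /total; apply: ge_ereal_sup => /= _ [A [finA _] <-].
  rewrite fsbig_finite //= -nneseries_sum => [|th i _]; last exact: (R0 i th).
  apply: lime_le.
    apply: is_cvg_nneseries => i _ _; by apply: sume_ge0 => th _; exact: (R0 i th).
  apply: nearW => n; apply: le_trans (partial n).
  apply: le_trans (leeDl _ (total_ge0 (N0 n))).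
  apply: lee_sum => i _; rewrite -fsbig_finite //.
  by apply: ereal_sup_ubound; exists A.
- split; first by apply: nneg_lin_ext => // th; exact: nneg_point.
  by apply: total_lin_ext => // th; [exact: nneg_point|rewrite total_point].
- have k0 (th th' : cqstate) (b : bool) : 0 <= (meas_prob b j th.2)%:E *
      point (upd th.1 X (b : nat)%:Z, collapse b j th.2) th'.
    by apply: mule_ge0; [rewrite lee_fin meas_prob_ge0|exact: nneg_point].
  split; first by apply: nneg_lin_ext => // th th'; exact: sume_ge0.
  apply: total_lin_ext => // th; first by move=> th'; exact: sume_ge0.
  rewrite /total esum_sum // big_bool /=.
  apply: (@le_trans _ _ ((meas_prob true j th.2)%:E + (meas_prob false j th.2)%:E)).
    by apply: leeD; apply: le_esumZ; rewrite ?lee_fin ?meas_prob_ge0 //;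
       try (exact: nneg_point); rewrite -/(total _) total_point.
  by rewrite -EFinD addrC meas_prob_sum.
Qed.

Definition cmd_sem (c : cmd R m sig PV) (Theta : subdist) : subdist :=
  let ok := mass_sem_le c (subdist_ge0 Theta) in
  SubDist ok.1 (le_trans ok.2 (subdist_le1 Theta)).

End Semantics.

Section Assertions.
Context (R : realType) (m : nat) (sig : opsig) (PV LV : eqType).
Local Notation assertion := (assertion R m sig PV LV).

Definition AOr (f g : assertion) : assertion := ANot (AAnd (ANot f) (ANot g)).

Fixpoint assertion_of_bexp (B : bexp sig PV) : assertion :=
  match B with
  | BTop => ATop
  | BBot => ABot
  | BRel r E1 E2 => ARel r (lexp_of_aexp LV E1) (lexp_of_aexp LV E2)
  | BNot B1 => ANot (assertion_of_bexp B1)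
  | BAnd B1 B2 => AAnd (assertion_of_bexp B1) (assertion_of_bexp B2)
  end.

Fixpoint sat (f : assertion) (I : LV -> int) (th : cqstate R m PV) : Prop :=
  match f with
  | ATop => True
  | ABot => False
  | AProj b j => \tr (ketbra R b *m ptrace j (density th.2)) = 1
  | ARel r e1 e2 => rop_sem r (leval e1 th.1 I) (leval e2 th.1 I)
  | ANot g => ~ sat g I th
  | AAnd g h => sat g I th /\ sat h I th
  | AForall x g => forall n : int, sat g (upd I x n) th
  | AGate U g => sat g I (th.1, apply_gate U th.2)
  | ABox b j g => 0 < meas_prob b j th.2 /\ sat g I (th.1, collapse b j th.2)
  | ABigAnd F => forall i, sat (F i) I th
  end.

Definition dsat (I : LV -> int) (Theta : subdist R m PV) (f : assertion) : Prop :=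
  forall th, supp Theta th -> sat f I th.

(* No capture can occur under AForall: E contains no logical variable. *)
Fixpoint subst (X : PV) (E : aexp sig PV) (f : assertion) : assertion :=
  match f with
  | ATop => ATop
  | ABot => ABot
  | AProj b j => AProj b j
  | ARel r e1 e2 => ARel r (lsubst X E e1) (lsubst X E e2)
  | ANot g => ANot (subst X E g)
  | AAnd g h => AAnd (subst X E g) (subst X E h)
  | AForall x g => AForall x (subst X E g)
  | AGate U g => AGate U (subst X E g)
  | ABox b j g => ABox b j (subst X E g)
  | ABigAnd F => ABigAnd (fun i => subst X E (F i))
  end.

(* f_1 /\ ... /\ f_n; the empty case does not arise, as the list of an rdist is
   never empty. *)
Definition conj_seq (s : seq assertion) : assertion :=
  if s is f :: s' then foldl (@AAnd R m sig PV LV) f s' else ATop.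

Fixpoint wp (c : cmd R m sig PV) (f : assertion) : assertion :=
  match c with
  | Skip => f
  | Assign X E => subst X E f
  | Rand X d => conj_seq [seq subst X (EInt ak.2) f | ak <- d]
  | Seq c1 c2 => wp c1 (wp c2 f)
  | If B c1 c2 =>
      AOr (AAnd (assertion_of_bexp B) (wp c1 f))
          (AAnd (ANot (assertion_of_bexp B)) (wp c2 f))
  | While B c1 =>
      ABigAnd (fun k => iter k
        (fun psi => AOr (AAnd (assertion_of_bexp B) (wp c1 psi))
                        (AAnd (ANot (assertion_of_bexp B)) f)) ATop)
  | Unitary U => AGate U f
  | Measure X j =>
      AAnd (AOr (ABox false j (subst X (EInt 0) f)) (AProj true j))
           (AOr (ABox true j (subst X (EInt 1) f)) (AProj false j))
  end.

End Assertions.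

(* Main.v *)
From mathcomp Require Import all_boot all_order all_algebra.
From mathcomp Require Import all_classical all_reals all_analysis complex.
Require Import Defs.

(** All weights being nonnegative, the support of the output mass is the set of
    states reachable with positive weight from the support of the input mass.
    The equivalence is proved by induction on the command, for all nonnegative
    masses at once; for a loop, the k-th approximant of the precondition speaks
    about the runs that exit after fewer than k iterations. *)

Set Implicit Arguments.
Unset Strict Implicit.
Unset Printing Implicit Defensive.

Import Order.TTheory GRing.Theory Num.Theory.

Local Open Scope classical_set_scope.
Local Open Scope ring_scope.

(** * Reduced density of one qubit and measurement probabilities *)

Section SingleQubitProjector.
Context (R : realType) (m : nat).

(** Partial trace is adjoint to tensoring with the identity: both sides add up the diagonal entries
    of [rho] at the basis states whose [j]-th bit is [b]. This ties the reading of [AProj] to the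
    probability used by [ABox] and by measurement. *)
Lemma tr_ketbra_ptrace b (j : 'I_m) (rho : 'M[R[i]]_(dim m)) :
  \tr (ketbra R b *m ptrace j rho) = \tr (proj R b j *m rho).
Proof.
set e := enum_rank ([ffun=> b] : bits 1).
(* The only nonzero entry of [ketbra R b] is at [(e, e)]. *)
have -> : \tr (ketbra R b *m ptrace j rho) = ptrace j rho e e.
  rewrite /mxtrace (bigD1 e) //= big1 ?addr0 => [|i ie]; rewrite mxE.
    rewrite (bigD1 e) //= big1 ?addr0 => [|k ke]; rewrite mxE.
      by rewrite !eqxx mul1r.
    by rewrite (negbTE ke) andbF mul0r.
  by rewrite big1 // => k _; rewrite mxE (negbTE ie) mul0r.
have atP (s : bits m) : enum_rank (bits_at [tuple j] s) = e <-> s j = b.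
  split=> [/enum_rank_inj/ffunP/(_ ord0)|sj].
    by rewrite !ffunE (tnth_nth j).
  by congr enum_rank; apply/ffunP => l; rewrite !ffunE !ord1 (tnth_nth j).
rewrite mxE /mxtrace [RHS](reindex (@enum_rank (bits m))) /=; last first.
  by exists enum_val => ? _; [exact: enum_rankK|exact: enum_valK].
apply: eq_bigr => s _; rewrite mxE [RHS](bigD1 (enum_rank s)) //=.
rewrite [X in _ = _ + X]big1 ?addr0 => [|c cs]; last first.
  by rewrite projE eq_sym (negbTE cs) mul0r.
rewrite projE (eqxx (enum_rank s)) enum_rankK /=.
have [sj|nsj] := eqVneq (s j) b; last first.
  rewrite mul0r big_pred0 // => t.
  by apply/negP => /and3P[_ /eqP/atP sj]; rewrite sj eqxx in nsj.
(* Agreement off [j] and the same bit at [j] force [t = s], so only a diagonal entry survives in the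
   inner sum. *)
rewrite mul1r (big_pred1 s) // => t /=.
apply/and3P/eqP => [[st _ /eqP/atP tj]|->]; last first.
  by split; [apply/forallP => i; rewrite (eqxx (s i)) implybT|exact/eqP/atP..].
apply/esym/(bits_at_inj st)/ffunP => l.
by rewrite !ffunE !ord1 (tnth_nth j) /= sj tj.
Qed.

(** The trace is a sum of squared moduli, hence real, so taking its real part in [meas_prob] loses
    nothing. *)
Lemma tr_ketbra_eq1 b (j : 'I_m) (th : qstate R m) :
  \tr (ketbra R b *m ptrace j (density th)) = 1 <-> meas_prob b j th = 1.
Proof.
rewrite tr_ketbra_ptrace tr_proj_density -meas_probE; split=> [h|->].
  by apply: complexI; rewrite h rmorph1.
by rewrite rmorph1.
Qed.

(** The probabilities of the two outcomes are nonnegative and add up to 1. *)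
Lemma meas_prob_gt0 b (j : 'I_m) (th : qstate R m) :
  0 < meas_prob b j th <-> meas_prob (~~ b) j th <> 1.
Proof.
have := meas_prob_sum j th; have := meas_prob_ge0 b j th.
rewrite le_eqVlt; case: b => /= /orP[/eqP <-|p0] s; split=> //.
- by rewrite ltxx.
- by move: s; rewrite addr0 => ->.
- by move=> _ h; move: s p0; rewrite h -[RHS]addr0 => /addrI ->; rewrite ltxx.
- by rewrite ltxx.
- by move: s; rewrite add0r => ->.
- by move=> _ h; move: s p0; rewrite h -[RHS]add0r => /addIr ->; rewrite ltxx.
Qed.

End SingleQubitProjector.

(** * Pointwise meaning of the assertions built by [wp] *)

Section Satisfaction.
Context (R : realType) (m : nat) (sig : opsig) (PV LV : eqType).
Implicit Types (f g : assertion R m sig PV LV) (I : LV -> int).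
Implicit Types (th : cqstate R m PV) (B : bexp sig PV).

Lemma leval_of_aexp (E : aexp sig PV) S I :
  leval (lexp_of_aexp LV E) S I = aeval E S.
Proof. by elim: E => //= o E1 -> E2 ->. Qed.

Lemma leval_lsubst X (E : aexp sig PV) (e : lexp sig PV LV) S I :
  leval (lsubst X E e) S I = leval e (upd S X (aeval E S)) I.
Proof.
elim: e => //= [Y|o e1 -> e2 ->] //.
by rewrite /upd; case: eqP => // _; exact: leval_of_aexp.
Qed.

Lemma sat_of_bexp B I th :
  sat (assertion_of_bexp R m LV B) I th <-> beval B th.1.
Proof.
elim: B => //= [r E1 E2|B IH|B1 IH1 B2 IH2].
- by rewrite !leval_of_aexp.
- by rewrite IH; split=> /negP.
- by rewrite IH1 IH2; split=> /andP.
Qed.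

(** The induction keeps [I] and [th] general: [AForall] changes the interpretation, while [AGate]
    and [ABox] change the quantum component, which commutes with a classical update. *)
Lemma sat_subst X E f I th :
  sat (subst X E f) I th <-> sat f I (upd th.1 X (aeval E th.1), th.2).
Proof.
elim: f I th => //=.
- by move=> r e1 e2 I th; rewrite !leval_lsubst.
- by move=> g IH I th; rewrite IH.
- by move=> g IHg h IHh I th; rewrite IHg IHh.
- by move=> x g IH I th; split=> h n; apply/IH; exact: h.
- by move=> b j g IH I th; rewrite IH.
- by move=> F IH I th; split=> h n; apply/IH; exact: h.
Qed.

Lemma sat_or f g I th : sat (AOr f g) I th <-> sat f I th \/ sat g I th.
Proof. by rewrite /= -not_orP notK. Qed.

Lemma sat_if B f g I th :
  sat (AOr (AAnd (assertion_of_bexp R m LV B) f)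
           (AAnd (ANot (assertion_of_bexp R m LV B)) g)) I th <->
  if beval B th.1 then sat f I th else sat g I th.
Proof.
rewrite sat_or /= sat_of_bexp; case: ifP => _; first by split=> [[[]|[]]|]; auto.
by split=> [[[]|[]]|]; auto.
Qed.

Lemma sat_conj_map (T : eqType) (F : T -> assertion R m sig PV LV) s I th :
  sat (conj_seq [seq F x | x <- s]) I th <->
  forall x, x \in s -> sat (F x) I th.
Proof.
case: s => [|x s] //=.
(* The accumulator of the left fold is generalised for the induction on [s]. *)
have -> : forall f, sat (foldl (@AAnd R m sig PV LV) f [seq F y | y <- s]) I th
    <-> sat f I th /\ forall y, y \in s -> sat (F y) I th.
  elim: s => [|y s IH] f /=; first by split=> [|[]].
  rewrite IH /=; split=> [[[h1 h2] h3]|[h1 h2]].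
    by split=> // z; rewrite inE => /predU1P[->|/h3].
  by split=> [|z zs]; [split=> //|]; apply: h2; rewrite inE ?eqxx ?zs ?orbT.
split=> [[h1 h2] y|h]; first by rewrite inE => /predU1P[->|/h2].
by split=> [|y ys]; apply: h; rewrite inE ?eqxx ?ys ?orbT.
Qed.

(** The disjunct [AProj (~~ b) j] holds exactly when outcome [b] is impossible, so the disjunction
    is a classical implication guarded by positive probability. *)
Lemma sat_box_or b (j : 'I_m) f I th :
  sat (AOr (ABox b j f) (AProj (~~ b) j)) I th <->
  (0 < meas_prob b j th.2 -> sat f I (th.1, collapse b j th.2)).
Proof.
rewrite sat_or /= tr_ketbra_eq1 meas_prob_gt0.
have [->|n1] := pselect (meas_prob (~~ b) j th.2 = 1); first by split; auto.
by split=> [[[]|]|h] //; left; split=> //; exact: h.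
Qed.

End Satisfaction.

(** * Positivity of finite and infinite sums of nonnegative terms *)

Section PositiveSums.
Context (R : realType).
Local Open Scope ereal_scope.

Lemma sume_gt0 (T : eqType) (s : seq T) (f : T -> \bar R) :
  (forall x, x \in s -> 0 <= f x) ->
  0 < \sum_(x <- s) f x <-> exists2 x, x \in s & 0 < f x.
Proof.
elim: s => [|y s IH] f0; first by rewrite big_nil ltxx; split=> // -[].
have f0s x : x \in s -> 0 <= f x by move=> xs; rewrite f0 // inE xs orbT.
have fy0 : 0 <= f y by rewrite f0 // inE eqxx.
rewrite big_cons; split=> [|[x]].
  move: fy0; rewrite le_eqVlt => /predU1P[<-|fy _]; last first.
    by exists y => //; rewrite inE eqxx.
  rewrite add0e => /(IH f0s)[x xs fx]; exists x => //.
  by rewrite inE xs orbT.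
rewrite inE => /predU1P[-> fx|xs fx].
  by rewrite (lt_le_trans fx) // leeDl // big_seq sume_ge0.
rewrite (@lt_le_trans _ _ (\sum_(x <- s) f x)) ?leeDr //.
by apply/IH => //; exists x.
Qed.

(** A positive term, as the sum over a singleton, bounds the whole sum from below; without one, all
    terms vanish. *)
Lemma esumT_gt0 (T : choiceType) (f : T -> \bar R) :
  (forall x, 0 <= f x) ->
  0 < \esum_(x in [set: T]) f x <-> exists x, 0 < f x.
Proof.
move=> f0; split=> [s0|[x fx]]; last first.
  apply: lt_le_trans fx _; rewrite -[leLHS](esum_set1 (f0 x)).
  by rewrite [leRHS](esumID [set x]) ?setTI ?leeDl // esum_ge0.
apply: contrapT => /forallNP n; move: s0; rewrite esum1 ?ltxx // => x _.
by apply/eqP; rewrite eq_le f0 andbT leNgt; apply/negP.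
Qed.

Lemma nneseries_gt0 (f : nat -> \bar R) : (forall i, 0 <= f i) ->
  0 < \sum_(0 <= i <oo) f i <-> exists i, 0 < f i.
Proof. by move=> f0; rewrite nneseries_esumT //; exact: esumT_gt0. Qed.

Lemma mule_gt0_iff (x y : \bar R) : 0 <= x -> 0 <= y ->
  0 < x * y <-> 0 < x /\ 0 < y.
Proof.
rewrite !le_eqVlt => /predU1P[<-|x0] /predU1P[<-|y0];
  rewrite ?mul0e ?mule0 ?ltxx; split=> [|[]] // _; by rewrite mule_gt0.
Qed.

End PositiveSums.

(** * Transfer of assertions along the semantics of masses *)

Section Masses.
Context (R : realType) (m : nat) (sig : opsig) (PV LV : eqType).
Local Notation mass := (cqstate R m PV -> \bar R).
Implicit Types (M : mass) (f g : assertion R m sig PV LV) (I : LV -> int).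
Implicit Types (X : PV) (E : aexp sig PV) (B : bexp sig PV) (U : gate R m).
Local Open Scope ereal_scope.

(** This is [dsat] for bare masses, so that the induction can pass through restrictions and loop
    iterates without carrying a bound on the total. *)
Definition msat I M f := forall th, 0 < M th -> sat f I th.

Lemma point_gt0 (th th' : cqstate R m PV) : 0 < point th th' <-> th' = th.
Proof.
by rewrite /point lte_fin ltr0n lt0b; split=> [/eqP|->].
Qed.

(** The output is positive at a state exactly when some [th] of positive mass has a kernel [k th]
    positive there. *)
Lemma msat_lin_ext I k M f :
  (forall th, nneg (k th)) -> nneg M ->
  msat I (lin_ext k M) f <-> (forall th, 0 < M th -> msat I (k th) f).
Proof.
move=> k0 M0.
have kM0 th th' : 0 <= M th * k th th' by rewrite mule_ge0 ?k0 ?M0.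
split=> h th Mth.
  move=> th' kth; apply: h; apply/esumT_gt0 => //.
  by exists th; rewrite mule_gt0.
move: Mth => /esumT_gt0[//|th0 /mule_gt0_iff[]]; [exact: M0|exact: k0|].
by move=> M1 k1; exact: h k1.
Qed.

Lemma msat_restrict I B M f :
  msat I (restrict B M) f <->
  forall th, beval B th.1 -> 0 < M th -> sat f I th.
Proof.
rewrite /msat /restrict; split=> h th; first by move=> b Mth; apply: h; rewrite b.
by case: ifP => [b Mth|]; [exact: h|rewrite ltxx].
Qed.

(** Serves both the conditional and one unfolding of a loop approximant. *)
Lemma msat_if I B M f g :
  msat I M (AOr (AAnd (assertion_of_bexp R m LV B) f)
                (AAnd (ANot (assertion_of_bexp R m LV B)) g)) <->
  msat I (restrict B M) f /\ msat I (restrict (BNot B) M) g.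
Proof.
rewrite !msat_restrict; split=> [h|[h1 h2] th Mth].
  by split=> th /= b Mth; have /sat_if := h _ Mth; rewrite ?b ?(negbTE b).
by apply/sat_if; case: ifPn => b; [exact: h1|exact: h2].
Qed.

Lemma msat_assign I X E M f : nneg M ->
  msat I M (subst X E f) <-> msat I (assign_sem X E M) f.
Proof.
move=> M0; rewrite msat_lin_ext //; last by move=> th; exact: nneg_point.
split=> h th Mth; last by apply/sat_subst; apply: (h _ Mth); exact/point_gt0.
by move=> th' /point_gt0 ->; apply/sat_subst; exact: h.
Qed.

Lemma msat_gate I U M f : nneg M ->
  msat I M (AGate U f) <-> msat I (gate_sem U M) f.
Proof.
move=> M0; rewrite msat_lin_ext //; last by move=> th; exact: nneg_point.
split=> h th Mth; last by apply: (h _ Mth); exact/point_gt0.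
by move=> th' /point_gt0 ->; exact: (h _ Mth).
Qed.

(** Since the weights are strictly positive, the support of the mixture is the union of the supports
    of its branches. *)
Lemma msat_rand I X (d : rdist R) M f : nneg M ->
  msat I M (wp (Rand X d) f) <-> msat I (mass_sem (Rand X d : cmd R m sig PV) M) f.
Proof.
move=> M0 /=.
have a0 ak : ak \in rdist_seq d -> 0 < ak.1%:E.
  by move=> /(allP (rdist_itv d)) /andP[]; rewrite lte_fin.
have A0 k th : 0 <= assign_sem X (EInt k : aexp sig PV) M th.
  exact: nneg_assign_sem.
have t0 ak th : ak \in rdist_seq d ->
    0 <= ak.1%:E * assign_sem X (EInt ak.2 : aexp sig PV) M th.
  by move=> /a0/ltW ?; rewrite mule_ge0.
transitivity (forall ak, ak \in rdist_seq d ->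
    msat I (assign_sem X (EInt ak.2 : aexp sig PV) M) f).
  split=> [h ak akd|h th Mth].
    by apply/msat_assign => // th /h /sat_conj_map; apply.
  by apply/sat_conj_map => ak akd; move/msat_assign : (h _ akd) => /(_ M0); apply.
split=> [h th /sume_gt0[ak akd|ak akd /mule_gt0_iff[|//|_]]|h ak akd th Ath].
- exact: t0.
- exact/ltW/a0.
- exact: h.
- apply: h; apply/sume_gt0 => [ak' ak'd|]; first exact: t0.
  by exists ak => //; rewrite mule_gt0 ?a0.
Qed.

Lemma msat_measure I X (j : 'I_m) M f : nneg M ->
  msat I M (wp (Measure X j) f) <-> msat I (measure_sem X j M) f.
Proof.
move=> M0.
have k0 (th th' : cqstate R m PV) (b : bool) : 0 <= (meas_prob b j th.2)%:E *
    point (upd th.1 X (b : nat)%:Z, collapse b j th.2) th'.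
  by apply: mule_ge0; [rewrite lee_fin meas_prob_ge0|exact: nneg_point].
rewrite msat_lin_ext //; last by move=> th th'; exact: sume_ge0.
(* One guarded condition per outcome. The guard matches the weight of the branch, so the default
   value of [collapse] at probability 0 never matters. *)
suff E th : sat (wp (Measure X j) f) I th <->
    forall b : bool, (0 < meas_prob b j th.2)%R ->
      sat f I (upd th.1 X (b : nat)%:Z, collapse b j th.2).
  split=> h th Mth; last first.
    apply/E => b p0; apply: (h _ Mth); apply/sume_gt0 => //.
    exists b; first exact: mem_index_enum.
    by rewrite mule_gt0 //; exact/point_gt0.
  move=> th' /sume_gt0[//|b _ /mule_gt0_iff[||p0 /point_gt0 ->]].
  - by rewrite lee_fin meas_prob_ge0.
  - exact: nneg_point.
  - by move/E: (h _ Mth); apply.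
have [hf ht] := (sat_box_or false j (subst X (EInt 0) f) I th,
                 sat_box_or true j (subst X (EInt 1) f) I th).
have -> : sat (wp (Measure X j) f) I th <->
    sat (AOr (ABox false j (subst X (EInt 0) f)) (AProj true j)) I th /\
    sat (AOr (ABox true j (subst X (EInt 1) f)) (AProj false j)) I th by [].
rewrite hf ht !sat_subst /=; split=> [[h0 h1] []//|h].
by split; [exact: (h false)|exact: (h true)].
Qed.

(** Both [M] and [f] vary in the induction: sequencing uses an intermediate mass and an intermediate
    precondition, and loops restart from later masses. *)
Lemma msat_wp (c : cmd R m sig PV) I M f : nneg M ->
  msat I M (wp c f) <-> msat I (mass_sem c M) f.
Proof.
elim: c M f => [|X E|X d|c1 IH1 c2 IH2|B c1 IH1 c2 IH2|B c1 IH1|U|X j] M f M0.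
- by [].
- exact: msat_assign.
- exact: msat_rand.
- by rewrite /= IH1 // IH2 //; have [] := mass_sem_le c1 M0.
- have N1 := nneg_restrict B M0; have N2 := nneg_restrict (BNot B) M0.
  rewrite /= msat_if IH1 // IH2 //.
  have [[S1 _] [S2 _]] := (mass_sem_le c1 N1, mass_sem_le c2 N2).
  (* A sum of two nonnegative masses is positive exactly where one of them is. *)
  split=> [[h1 h2] th|h].
    have := S1 th; rewrite le_eqVlt => /predU1P[<-|/h1//].
    by rewrite add0e => /h2.
  split=> th s; apply: h.
    by rewrite (lt_le_trans s) // leeDl.
  by rewrite (lt_le_trans s) // leeDr.
- set step := fun M' : mass => mass_sem c1 (restrict B M').
  have step0 M' : nneg M' -> nneg (step M').
    by move=> /(nneg_restrict B) /(mass_sem_le c1)[].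
  have iter0 i : nneg (iter i step M) by elim: i => //= i; exact: step0.
  (* Both sides say that [f] holds on exit after [i] rounds, for every [i]. *)
  transitivity (forall i, msat I (restrict (BNot B) (iter i step M)) f).
    set psi := fun psi' => AOr (AAnd (assertion_of_bexp R m LV B) (wp c1 psi'))
                               (AAnd (ANot (assertion_of_bexp R m LV B)) f).
    (* The bound is strict because the approximant of index 0 is [ATop], which constrains no exit.
       The mass stays general since unfolding [psi] once moves the first round into it. *)
    have approx k M' : nneg M' -> msat I M' (iter k psi ATop) <->
        forall i, (i < k)%N -> msat I (restrict (BNot B) (iter i step M')) f.
      elim: k M' => [|k IHk] M' M'0; first by split.
      rewrite iterS msat_if IH1; last exact: nneg_restrict.
      rewrite IHk; last exact: step0.
      (* Exit at index 0 is the [BNot B] branch; exit at [i.+1] from [M'] is exit at [i] from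
         [step M']. *)
      split=> [[h1 h2] [|i] ik //|h]; first by rewrite iterSr; exact: h1.
      split=> [i ik|]; last exact: (h 0%N).
      by rewrite -iterSr; exact: h.
    split=> [h i|h th Mth k]; last by apply: ((approx k M M0).2 _ th Mth).
    (* The first approximant that covers exit after [i] rounds has index [i.+1]. *)
    apply: ((approx i.+1 M M0).1 _ i (ltnSn i)) => th Mth.
    exact: h Mth i.+1.
  split=> [h th /nneseries_gt0[i|i]|h i th s]; last 1 first.
  + apply: h; apply/nneseries_gt0 => [j|]; last by exists i.
    exact: nneg_restrict (iter0 j) th.
  + exact: nneg_restrict (iter0 i) th.
  + exact: h.
- exact: msat_gate.
- exact: msat_measure.
Qed.

End Masses.

Theorem theorem2 (R : realType) (m : nat) (sig : opsig) (PV LV : eqType)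
    (C : cmd R m sig PV) (phi : assertion R m sig PV LV) (I : LV -> int)
    (Theta : subdist R m PV) :
  dsat I Theta (wp C phi) <-> dsat I (cmd_sem C Theta) phi.
Proof. exact: msat_wp (subdist_ge0 Theta). Qed.
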